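(* Let $c>0$, $\lambda=c^{-2}$, let $P_\infty=\mathrm{Poi}(\lambda)$ and let $Q_\infty$ be the law of $1+J$ with $J\sim\mathrm{Poi}(\lambda)$. Then for every $\varepsilon\ge0$, $$\delta_{Q_\infty\|P_\infty}(\varepsilon)=\sum_{j\ge0}\bigl(P_\infty(j-1)-e^{\varepsilon}P_\infty(j)\bigr)_+,\qquad P_\infty(-1):=0.$$ Moreover, the two-sided curve has a support-mismatch floor: $$\delta_{\mathrm{two}}(\varepsilon)\ge\delta_{P_\infty\|Q_\infty}(\varepsilon)\ge P_\infty(\{0\})=e^{-\lambda}\qquad\text{for all }\varepsilon\ge0.$$
   Context: For probability measures $P,Q$ on a common measurable space and $\varepsilon\ge0$, $\delta_{Q\|P}(\varepsilon):=\sup_A\{Q(A)-e^{\varepsilon}P(A)\}$ over measurable $A$, and $\delta_{\mathrm{two}}(\varepsilon):=\max\{\delta_{Q_\infty\|P_\infty}(\varepsilon),\delta_{P_\infty\|Q_\infty}(\varepsilon)\}$. $(u)_+:=\max\{u,0\}$, and $P_\infty(j)$ denotes $P_\infty(\{j\})$. *)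

(* Defs.v *)
From HB Require Import structures.
From mathcomp Require Import all_boot all_order all_algebra.
From mathcomp Require Import all_classical all_reals all_analysis.

Set Implicit Arguments.
Unset Strict Implicit.
Unset Printing Implicit Defensive.

Import Order.TTheory GRing.Theory Num.Theory.

Local Open Scope classical_set_scope.
Local Open Scope ring_scope.
Local Open Scope ereal_scope.

Definition privacy_curve (d : measure_display) (T : measurableType d)
    (R : realType) (Q P : probability T R) (eps : R) : \bar R :=
  ereal_sup [set Q A - (expR eps)%:E * P A | A in @measurable d T].

Definition two_sided_curve (d : measure_display) (T : measurableType d)
    (R : realType) (Q P : probability T R) (eps : R) : \bar R :=
  maxe (privacy_curve Q P eps) (privacy_curve P Q eps).

(* The nat argument of poisson_prob is unused by its definition, so the value
   0 is arbitrary. *)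
Definition Poi (R : realType) (lam : R) : probability nat R :=
  poisson_prob lam 0%N.

Definition one_plus (j : nat) : nat := (1 + j)%N.

Lemma measurable_one_plus : measurable_fun [set: nat] one_plus.
Proof. by []. Qed.

HB.instance Definition _ :=
  isMeasurableFun.Build _ _ nat nat one_plus measurable_one_plus.

(* The law of 1 + J, where J ~ Poi lam is realized as the identity on the
   probability space (nat, Poi lam). *)
Definition shifted_Poi (R : realType) (lam : R) : probability nat R :=
  distribution (Poi lam) one_plus.

(* The mass P({j - 1}), equal to 0 when j = 0. *)
Definition mass_pred (R : realType) (P : probability nat R) (j : nat) : \bar R :=
  if j is i.+1 then P [set i] else 0.

Definition pos_part (R : realType) (u : \bar R) : \bar R := maxe u 0.

(* Main.v *)
(* The supremum is attained at [A = {j | e^eps P{j} <= Q{j}}]: on a discrete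
   space [Q A - e^eps P A] is the sum over [A] of the signed atomic
   differences, and this [A] keeps exactly the nonnegative ones. For the floor,
   take the event [{0}], which the shifted law does not charge. *)
Require Import Defs.
From mathcomp Require Import all_boot all_order all_algebra.
From mathcomp Require Import all_classical all_reals all_analysis.

Import Order.TTheory GRing.Theory Num.Theory.

Local Open Scope classical_set_scope.
Local Open Scope ring_scope.
Local Open Scope ereal_scope.

(** Countable additivity: [A] is the disjoint union of its singletons, and every subset of [nat] is
    measurable. *)
Lemma nat_measure_esum {R : realType} (mu : {measure set nat -> \bar R})
    (A : set nat) :
  mu A = \esum_(k in A) mu [set k].
Proof.
rewrite -[in RHS](set_mem_set A) -nneseries_esum//.
rewrite -measure_bigcup// ?bigcup_imset1 ?image_id//.
by move=> i j _ _ [k [/= -> ->]].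
Qed.

Lemma pos_part_ge0 {R : realType} (u : \bar R) : 0 <= pos_part u.
Proof. by rewrite /pos_part le_max lexx orbT. Qed.

Lemma privacy_curve_nat {R : realType} (Q P : probability nat R) (eps : R) :
  privacy_curve Q P eps =
  \sum_(0 <= j <oo) pos_part (Q [set j] - (expR eps)%:E * P [set j]).
Proof.
(* Packaging [e^eps P] as a measure lets [nat_measure_esum] split it into atoms just like [Q]. *)
pose M : {measure set nat -> \bar R} := mscale (NngNum (expR_ge0 eps)) P.
pose g j := pos_part (Q [set j] - M [set j]).
have g_ge0 j : 0 <= g j by exact: pos_part_ge0.
have finM A : M A \is a fin_num by rewrite fin_numM// fin_num_measure.
rewrite nneseries_esumT//; apply/eqP; rewrite eq_le; apply/andP; split.
(* The finite term [M A] is moved to the right, so that only sums of nonnegative terms are compared;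
   [g_ge0] then allows the sum of [g] to be restricted to [A]. *)
- apply: ge_ereal_sup => _ [A _ <-]; rewrite leeBlDr; last exact: finM.
  rewrite [leRHS](_ : _ = \esum_(j in [set: nat]) g j + M A)//.
  apply: (@le_trans _ _ (\esum_(j in A) g j + M A)); last first.
    rewrite leeD2r// esum_mkcond; apply: le_esum => j _.
    by case: ifPn.
  rewrite (nat_measure_esum Q) (nat_measure_esum M) -esumD//.
  apply: le_esum => j _; rewrite -leeBlDr; last exact: finM.
  by rewrite /g /pos_part le_max lexx.
- pose A := [set j | M [set j] <= Q [set j]].
  apply: ereal_sup_ubound; exists A => //.
  rewrite [LHS](_ : _ = Q A - M A)//.
  have -> : Q A = \esum_(j in A) g j + M A.
    rewrite (nat_measure_esum Q) (nat_measure_esum M) -esumD//.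
    apply: eq_esum => j Aj.
    rewrite /g /pos_part max_l ?subeK// sube_ge0//; apply/orP; left.
    exact: finM.
  rewrite addeK//.
  (* Off [A] the difference is negative, so [g] vanishes there and the sum over [A] is the full
     sum. *)
  rewrite [LHS]esum_mkcond; apply: eq_esum => j _; case: ifPn => // /negP Aj.
  rewrite -/(g j) /g /pos_part max_r// sube_le0.
  by apply: ltW; rewrite ltNge; apply/negP => /mem_set.
Qed.

(** The preimage of [{0}] under [one_plus] is empty, whence the convention for mass at [-1]; that of
    [{j + 1}] is [{j}]. *)
Lemma shifted_Poi_set1 {R : realType} (lam : R) (j : nat) :
  shifted_Poi lam [set j] = mass_pred (Poi lam) j.
Proof.
rewrite /shifted_Poi /distribution /pushforward; case: j => [|j] /=.
  by rewrite (_ : _ @^-1` _ = set0) ?measure0//; apply/seteqP; split.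
congr (Poi lam _); apply/seteqP; split => k /=; rewrite /one_plus add1n.
  by case.
by move->.
Qed.

Lemma Poi_set0 {R : realType} (lam : R) :
  (0 < lam)%R -> Poi lam [set 0%N] = (expR (- lam))%:E.
Proof.
(* Both [poisson_prob] and [poisson_pmf] test the sign of the rate; [lam_gt0] selects the genuine
   Poisson branch. *)
move=> lam_gt0; rewrite /Poi /= /poisson_prob lam_gt0 esum_set1.
  by rewrite /poisson_pmf lam_gt0 expr0 fact0 invr1 !mul1r.
by rewrite lee_fin poisson_pmf_ge0.
Qed.

Theorem proposition3p5 (R : realType) (c lam : R)
    (c_gt0 : (0 < c)%R) (lamE : lam = (c ^- 2)%R) :
  let Pinf := Poi lam in
  let Qinf := shifted_Poi lam in
  (forall eps : R, (0 <= eps)%R ->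
     privacy_curve Qinf Pinf eps =
     \sum_(0 <= j <oo)
        pos_part (mass_pred Pinf j - (expR eps)%:E * Pinf [set j])) /\
  (forall eps : R, (0 <= eps)%R ->
     [/\ privacy_curve Pinf Qinf eps <= two_sided_curve Qinf Pinf eps,
         Pinf [set 0%N] <= privacy_curve Pinf Qinf eps &
         Pinf [set 0%N] = (expR (- lam))%:E]).
Proof.
move=> Pinf Qinf; split=> eps _.
  rewrite privacy_curve_nat; apply: eq_eseriesr => j _.
  by rewrite /Qinf shifted_Poi_set1.
split.
- by rewrite /two_sided_curve le_max lexx orbT.
- apply: ereal_sup_ubound; exists [set 0%N] => //.
  by rewrite /Qinf shifted_Poi_set1 mule0 sube0.
- by apply: Poi_set0; rewrite lamE invr_gt0 exprn_gt0.
Qed.
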